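(* Every $\omega$-model of $\mathrm{SRT}^2_2$ (i.e., every Turing ideal $\mathcal I$ such that every stable 2-coloring of $[\mathbb N]^2$ in $\mathcal I$ has an infinite homogeneous set in $\mathcal I$) is a model of $\mathrm{DNR}$: for every $X\in\mathcal I$ there is a function $h\in\mathcal I$ that is diagonally noncomputable relative to $X$.
   Context: A Turing ideal is a nonempty subset of $2^\omega$ closed under Turing reducibility and join. A 2-coloring $C$ of $[\mathbb N]^2$ is stable if for each $x$ there are $y$ and $c<2$ with $C(\{x,z\})=c$ for all $z>y$; $H$ is homogeneous for $C$ if $C$ is constant on $[H]^2$. A total function $h:\mathbb N\to\mathbb N$ is diagonally noncomputable relative to $X$ if $h(e)\neq\Phi^X_e(e)$ for all $e$ (where $\Phi^X_e$ is the $e$-th Turing functional with oracle $X$, and the inequality holds trivially when $\Phi^X_e(e)$ diverges). $\mathrm{DNR}$ is the principle: for every set $X$ there is a function diagonally noncomputable relative to $X$. *)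

(* Defs.v *)
From HB Require Import structures.
From mathcomp Require Import all_boot.
Set Implicit Arguments. Unset Strict Implicit. Unset Printing Implicit Defensive.

(* Subsets of N (elements of 2^omega) are characteristic functions. *)
Definition set2w := nat -> bool.

Definition npair (x y : nat) : nat := (2 ^ x * (2 * y + 1)).-1.
Definition nfst (n : nat) : nat := logn 2 n.+1.
Definition nsnd (n : nat) : nat := ((n.+1 %/ 2 ^ nfst n).-1)./2.

Inductive prog : Type :=
| PZero
| PSucc
| PId
| POracle
| PFst
| PSnd
| PPair of prog & prog
| PComp of prog & prog
| PRec of prog & prog
| PMu of prog.

Inductive eval (X : set2w) : prog -> nat -> nat -> Prop :=
| EZero x : eval X PZero x 0
| ESucc x : eval X PSucc x x.+1
| EId x : eval X PId x x
| EOracle x : eval X POracle x (nat_of_bool (X x))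
| EFst x : eval X PFst x (nfst x)
| ESnd x : eval X PSnd x (nsnd x)
| EPair f g x a b : eval X f x a -> eval X g x b -> eval X (PPair f g) x (npair a b)
| EComp f g x y z : eval X g x y -> eval X f y z -> eval X (PComp f g) x z
| ERec0 f g a y : eval X f a y -> eval X (PRec f g) (npair a 0) y
| ERecS f g a n y z : eval X (PRec f g) (npair a n) y ->
    eval X g (npair a (npair n y)) z -> eval X (PRec f g) (npair a n.+1) z
| EMu f x n : eval X f (npair x n) 0 ->
    (forall m, m < n -> exists k, eval X f (npair x m) k.+1) ->
    eval X (PMu f) x n.

(* Goedel numbering of programs via a generic tree encoding. *)
Fixpoint prog_enc (p : prog) : GenTree.tree nat :=
  match p with
  | PZero => GenTree.Node 0 [::]
  | PSucc => GenTree.Node 1 [::]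
  | PId => GenTree.Node 2 [::]
  | POracle => GenTree.Node 3 [::]
  | PFst => GenTree.Node 4 [::]
  | PSnd => GenTree.Node 5 [::]
  | PPair f g => GenTree.Node 6 [:: prog_enc f; prog_enc g]
  | PComp f g => GenTree.Node 7 [:: prog_enc f; prog_enc g]
  | PRec f g => GenTree.Node 8 [:: prog_enc f; prog_enc g]
  | PMu f => GenTree.Node 9 [:: prog_enc f]
  end.

Fixpoint prog_dec (t : GenTree.tree nat) : option prog :=
  match t with
  | GenTree.Node 0 [::] => Some PZero
  | GenTree.Node 1 [::] => Some PSucc
  | GenTree.Node 2 [::] => Some PId
  | GenTree.Node 3 [::] => Some POracle
  | GenTree.Node 4 [::] => Some PFst
  | GenTree.Node 5 [::] => Some PSnd
  | GenTree.Node 6 [:: t1; t2] =>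
      if prog_dec t1 is Some f then if prog_dec t2 is Some g then Some (PPair f g) else None else None
  | GenTree.Node 7 [:: t1; t2] =>
      if prog_dec t1 is Some f then if prog_dec t2 is Some g then Some (PComp f g) else None else None
  | GenTree.Node 8 [:: t1; t2] =>
      if prog_dec t1 is Some f then if prog_dec t2 is Some g then Some (PRec f g) else None else None
  | GenTree.Node 9 [:: t1] =>
      if prog_dec t1 is Some f then Some (PMu f) else None
  | _ => None
  end.

Lemma prog_encK : pcancel prog_enc prog_dec.
Proof. by elim=> //= f -> // g ->. Qed.

HB.instance Definition _ := Countable.copy prog (pcan_type prog_encK).

Definition Phi (X : set2w) (e x y : nat) : Prop :=
  match (unpickle e : option prog) with
  | Some p => eval X p x y
  | None => False
  end.

Definition computable_in (X : set2w) (f : nat -> nat) : Prop :=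
  exists e, forall n, Phi X e n (f n).

Definition Treducible (A X : set2w) : Prop :=
  computable_in X (fun n => nat_of_bool (A n)).

Definition tjoin (X Y : set2w) : set2w :=
  fun n => if odd n then Y n./2 else X n./2.

Definition turing_ideal (I : set2w -> Prop) : Prop :=
  [/\ exists X, I X,
      forall X Y, I X -> Treducible Y X -> I Y
    & forall X Y, I X -> I Y -> I (tjoin X Y)].

(* A function belongs to I if it is computable from some member of I
   (equivalently, by closure, its graph coded as a set belongs to I). *)
Definition fun_in (I : set2w -> Prop) (f : nat -> nat) : Prop :=
  exists Y, I Y /\ computable_in Y f.

(* 2-colorings of [N]^2: C x y is the colour of {x,y}, used only for x < y. *)
Definition coloring := nat -> nat -> bool.

Definition coloring_in (I : set2w -> Prop) (C : coloring) : Prop :=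
  fun_in I (fun n => nat_of_bool (C (nfst n) (nsnd n))).

Definition stable (C : coloring) : Prop :=
  forall x, exists y (c : bool), forall z, y < z -> x < z -> C x z = c.

Definition homogeneous (C : coloring) (H : set2w) : Prop :=
  exists c : bool, forall x y, H x -> H y -> x < y -> C x y = c.

Definition infinite_set (H : set2w) : Prop :=
  forall n, exists m, n <= m /\ H m.

Definition SRT22_model (I : set2w -> Prop) : Prop :=
  turing_ideal I /\
  forall C : coloring, coloring_in I C -> stable C ->
    exists H, I H /\ infinite_set H /\ homogeneous C H.

Definition DNR_rel (X : set2w) (h : nat -> nat) : Prop :=
  forall e y, Phi X e e y -> h e <> y.

Definition DNR_model (I : set2w -> Prop) : Prop :=
  forall X, I X -> exists h, fun_in I h /\ DNR_rel X h.

(* Main.v *)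
(** Let r = <c, e> range over pairs of a program and an input, let D_r be the set
    of the first N(r) numbers coded by the output of c on e (if any), and let the
    owner of x be the least r <= x with x in D_r.  Colouring x according to whether
    it is the least number with its owner gives a limit computable set: computing
    owners with the outputs found by stage s yields a stable colouring C(x, s).
    As N grows fast enough, a D_r of full size N(r) keeps at least two numbers
    owned by r, so it is not monochromatic.  Hence a code of sufficiently many
    elements of an infinite homogeneous set H cannot be the output of the program
    with index e on input e, and such a code is computable from H.

    The stages need a universal machine.  It runs on the transparent program codes
    [pcode] instead of the Goedel numbers of [Phi]: it is enough to bound
    computably the code of the program with Goedel number e, and to let h(e) defeat
    all the programs below that bound. *)
Require Import Defs.
From Stdlib Require Import Classical.
From mathcomp Require Import all_boot zify.
Set Implicit Arguments. Unset Strict Implicit. Unset Printing Implicit Defensive.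

(** * The pairing function *)

Lemma npair_succ x y : (npair x y).+1 = 2 ^ x * (2 * y + 1).
Proof. by rewrite /npair prednK // muln_gt0 expn_gt0 addn1. Qed.

Lemma npairKl x y : nfst (npair x y) = x.
Proof.
rewrite /nfst npair_succ lognM ?expn_gt0 ?addn1 // pfactorK //.
by rewrite lognE dvdn2 /= mul2n odd_double addn0.
Qed.

Lemma npairKr x y : nsnd (npair x y) = y.
Proof.
rewrite /nsnd npairKl npair_succ mulKn ?expn_gt0 // addn1 /=.
by rewrite mul2n doubleK.
Qed.

Lemma leq_npair x x' y y' : x <= x' -> y <= y' -> npair x y <= npair x' y'.
Proof.
move=> lex ley; rewrite -ltnS !npair_succ.
by rewrite leq_mul ?leq_exp2l // leq_add2r leq_mul2l.
Qed.

Arguments npair : simpl never.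
Arguments nfst : simpl never.
Arguments nsnd : simpl never.
Opaque npair nfst nsnd.

(** * Closure properties of the functions computable in [X] *)

Section ComputableFunctions.

Variable X : set2w.
Implicit Types (f g a b k : nat -> nat) (p : prog).

Lemma computable_inP f :
  computable_in X f <-> exists p, forall n, eval X p n (f n).
Proof.
split=> [[e ef]|[p pf]]; last first.
  by exists (pickle p) => n; rewrite /Phi pickleK.
move: ef; rewrite /Phi; case: (unpickle e) => [p|] ef; first by exists p.
by case: (ef 0).
Qed.

Lemma eq_computable f g : f =1 g -> computable_in X f -> computable_in X g.
Proof. by move=> fg [e ef]; exists e => n; rewrite -fg. Qed.

Lemma computable_id : computable_in X id.
Proof. by apply/computable_inP; exists PId => n; constructor. Qed.

Lemma computable_comp f a :
  computable_in X f -> computable_in X a -> computable_in X (fun n => f (a n)).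
Proof.
move=> /computable_inP[p pf] /computable_inP[q qa]; apply/computable_inP.
by exists (PComp p q) => n; apply: EComp (qa n) (pf _).
Qed.

Lemma computable_succ a :
  computable_in X a -> computable_in X (fun n => (a n).+1).
Proof.
apply: (@computable_comp S); apply/computable_inP.
by exists PSucc => n; constructor.
Qed.

Lemma computable_const c : computable_in X (fun=> c).
Proof.
elim: c => [|c IHc]; last exact: computable_succ IHc.
by apply/computable_inP; exists PZero => n; constructor.
Qed.

Lemma computable_oracle a :
  computable_in X a -> computable_in X (fun n => X (a n)).
Proof.
apply: (@computable_comp X); apply/computable_inP.
by exists POracle => n; constructor.
Qed.

Lemma computable_fst a :
  computable_in X a -> computable_in X (fun n => nfst (a n)).
Proof.
apply: computable_comp; apply/computable_inP.
by exists PFst => n; constructor.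
Qed.

Lemma computable_snd a :
  computable_in X a -> computable_in X (fun n => nsnd (a n)).
Proof.
apply: computable_comp; apply/computable_inP.
by exists PSnd => n; constructor.
Qed.

Lemma computable_pair a b :
  computable_in X a -> computable_in X b ->
  computable_in X (fun n => npair (a n) (b n)).
Proof.
move=> /computable_inP[p pa] /computable_inP[q qb]; apply/computable_inP.
by exists (PPair p q) => n; constructor.
Qed.

Lemma computable_rec f (G : nat -> nat -> nat -> nat) k :
  computable_in X f ->
  computable_in X (fun z => G (nfst z) (nfst (nsnd z)) (nsnd (nsnd z))) ->
  computable_in X k ->
  computable_in X (fun n => nat_rect (fun=> nat) (f n) (G n) (k n)).
Proof.
move=> /computable_inP[p pf] /computable_inP[q qG] /computable_inP[r rk].
apply/computable_inP; exists (PComp (PRec p q) (PPair PId r)) => n.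
apply: EComp (EPair (EId _ _) (rk n)) _.
elim: (k n) => [|m IHm]; first exact: ERec0.
apply: ERecS IHm _; set y := nat_rect _ _ _ _.
by have := qG (npair n (npair m y)); rewrite !(npairKl, npairKr).
Qed.

Lemma computable_case f a (G : nat -> nat -> nat) :
  computable_in X a -> computable_in X f ->
  computable_in X (fun z => G (nfst z) (nsnd z)) ->
  computable_in X (fun n => if a n is m.+1 then G n m else f n).
Proof.
move=> ca cf cG.
have cG' : computable_in X (fun z => G (nfst z) (nfst (nsnd z))).
  apply: eq_computable (computable_comp cG (computable_pair
    (computable_fst computable_id)
    (computable_fst (computable_snd computable_id)))) => z /=.
  by rewrite npairKl npairKr.
apply: eq_computable (@computable_rec f (fun n m _ => G n m) a cf cG' ca) => n.
by case: (a n).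
Qed.

Lemma computable_iter (F : nat -> nat -> nat) k a :
  computable_in X (fun z => F (nfst z) (nsnd z)) -> computable_in X k ->
  computable_in X a -> computable_in X (fun n => iter (k n) (F n) (a n)).
Proof.
move=> cF ck ca.
have cF' : computable_in X (fun z => F (nfst z) (nsnd (nsnd z))).
  apply: eq_computable (computable_comp cF (computable_pair
    (computable_fst computable_id)
    (computable_snd (computable_snd computable_id)))) => z /=.
  by rewrite npairKl npairKr.
apply: eq_computable (@computable_rec a (fun n _ y => F n y) k ca cF' ck) => n.
by elim: (k n) => //= m ->.
Qed.

Lemma computable_pred a :
  computable_in X a -> computable_in X (fun n => (a n).-1).
Proof.
move=> ca; apply: eq_computable (@computable_case (fun=> 0) a (fun _ m => m) ca
  (computable_const 0) (computable_snd computable_id)) => n.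
by case: (a n).
Qed.

Lemma computable_add a b :
  computable_in X a -> computable_in X b ->
  computable_in X (fun n => a n + b n).
Proof.
move=> ca cb; apply: eq_computable
  (@computable_iter (fun _ y => y.+1) a b _ ca cb) => [n|].
  by elim: (a n) => //= m ->.
exact: computable_succ (computable_snd computable_id).
Qed.

Lemma computable_sub a b :
  computable_in X a -> computable_in X b ->
  computable_in X (fun n => a n - b n).
Proof.
move=> ca cb; apply: eq_computable
  (@computable_iter (fun _ y => y.-1) b a _ cb ca) => [n|].
  by elim: (b n) => [|m /= ->]; rewrite ?subn0 ?subnS.
exact: computable_pred (computable_snd computable_id).
Qed.

Lemma computable_if (c : nat -> bool) f g :
  computable_in X c -> computable_in X f -> computable_in X g ->
  computable_in X (fun n => if c n then f n else g n).
Proof.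
move=> cc cf cg.
have cf' : computable_in X (fun z => f (nfst z)).
  exact: computable_comp cf (computable_fst computable_id).
apply: eq_computable (@computable_case g _ (fun n _ => f n) cc cg cf') => n.
by case: (c n).
Qed.

Lemma computable_neg (c : nat -> bool) :
  computable_in X c -> computable_in X (fun n => ~~ c n).
Proof.
move=> cc; apply: eq_computable
  (computable_if cc (computable_const 0) (computable_const 1)) => n.
by case: (c n).
Qed.

Lemma computable_and (c d : nat -> bool) :
  computable_in X c -> computable_in X d ->
  computable_in X (fun n => c n && d n).
Proof.
move=> cc cd; apply: eq_computable
  (computable_if cc cd (computable_const 0)) => n.
by case: (c n).
Qed.

(** Two numbers agree exactly when the sum of both truncated differences vanishes. *)
Lemma computable_eq a b :
  computable_in X a -> computable_in X b ->
  computable_in X (fun n => a n == b n).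
Proof.
move=> ca cb.
have cd := computable_add (computable_sub ca cb) (computable_sub cb ca).
apply: eq_computable (@computable_case (fun=> 1) _ (fun _ _ => 0) cd
  (computable_const _) (computable_const _)) => n.
by rewrite eqn_leq -!subn_eq0 -addn_eq0; case: (_ + _).
Qed.

Lemma computable_mu (P : nat -> pred nat) g :
  computable_in X (fun z => P (nfst z) (nsnd z)) ->
  (forall n, P n (g n)) -> (forall n m, P n m -> g n <= m) ->
  computable_in X g.
Proof.
(* [PMu] searches for a zero, hence the negation. *)
move=> /computable_neg /computable_inP[p pP] Pg ming.
apply/computable_inP; exists (PMu p) => n; constructor=> [|m ltm].
  by have := pP (npair n (g n)); rewrite npairKl npairKr Pg.
exists 0; have := pP (npair n m); rewrite npairKl npairKr.
by case: (boolP (P n m)) => [/ming|//]; rewrite leqNgt ltm.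
Qed.

Lemma computable_find (P : nat -> pred nat) k :
  computable_in X (fun z => P (nfst z) (nsnd z)) -> computable_in X k ->
  computable_in X (fun n => find (P n) (iota 0 (k n))).
Proof.
(* The extra disjunct stops the unbounded search at [k n], the value of a failing [find]. *)
move=> cP ck; apply: (@computable_mu (fun n m => P n m || (m == k n))).
- have c : computable_in X (fun z => nsnd z == k (nfst z)).
    by apply: computable_eq; [apply: computable_snd computable_id|
       apply: computable_comp ck (computable_fst computable_id)].
  apply: eq_computable (computable_if cP (computable_const 1) c) => z.
  by case: (P _ _).
- move=> n; case: (boolP (has (P n) (iota 0 (k n)))) => [hP|/hasNfind->].
    have := nth_find 0 hP; rewrite nth_iota ?add0n => [->//|].
    by rewrite has_find size_iota in hP.
  by rewrite size_iota eqxx orbT.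
move=> n m; rewrite leqNgt => /orP H; apply/negP=> ltm.
have ltk : m < k n.
  by apply: leq_trans ltm _; rewrite -[leqRHS](size_iota 0) find_size.
case: H => [|/eqP em]; last by rewrite em ltnn in ltk.
by have := before_find 0 ltm; rewrite nth_iota // add0n => ->.
Qed.

Lemma computable_has (P : nat -> pred nat) k :
  computable_in X (fun z => P (nfst z) (nsnd z)) -> computable_in X k ->
  computable_in X (fun n => has (P n) (iota 0 (k n))).
Proof.
move=> cP ck; apply: eq_computable
  (computable_neg (computable_eq (computable_find cP ck) ck)) => n.
by rewrite has_find size_iota ltn_neqAle -[X in _ && (_ <= X)](size_iota 0)
  find_size andbT.
Qed.

End ComputableFunctions.

(* Unification may leave eta-reduced goals such as [computable_in X nsnd]: they are
   the reason for the instances at [id]. *)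
Ltac comput :=
  lazymatch goal with
  | |- computable_in _ (fun n => nat_of_bool (@?a n == @?b n)) =>
      apply (@computable_eq _ a b); comput
  | |- computable_in ?X (fun n => nat_of_bool (?X (@?a n))) =>
      apply (@computable_oracle X a); comput
  | |- computable_in _ (fun n => npair (@?a n) (@?b n)) =>
      apply (@computable_pair _ a b); comput
  | |- computable_in _ (fun n => nfst (@?a n)) =>
      apply (@computable_fst _ a); comput
  | |- computable_in _ (fun n => nsnd (@?a n)) =>
      apply (@computable_snd _ a); comput
  | |- computable_in _ (fun n => (@?a n).-1) =>
      apply (@computable_pred _ a); comput
  | |- computable_in _ (fun n => if _ then _ else _) =>
      apply: computable_if; comput
  | |- computable_in _ (fun n => (@?a n).+1) =>
      apply (@computable_succ _ a); comput
  | _ => first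
      [ assumption
      | match goal with H : computable_in ?X ?f
          |- computable_in ?X (fun n => ?f (@?a n)) =>
          apply (@computable_comp X f a H); comput
        end
      | apply computable_id | apply computable_const
      | apply (@computable_succ _ id), computable_id
      | apply (@computable_fst _ id), computable_id
      | apply (@computable_snd _ id), computable_id | idtac ]
  end.

(** * A universal machine for oracle programs *)

Definition push i K := (npair i K).+1.

Fixpoint pcode (p : prog) : nat :=
  match p with
  | PZero => npair 0 0
  | PSucc => npair 1 0
  | PId => npair 2 0
  | POracle => npair 3 0
  | PFst => npair 4 0
  | PSnd => npair 5 0
  | PPair f g => npair 6 (npair (pcode f) (pcode g))
  | PComp f g => npair 7 (npair (pcode f) (pcode g))
  | PRec f g => npair 8 (npair (pcode f) (pcode g))
  | PMu f => npair 9 (pcode f)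
  end.

(* An abstract machine whose configuration [npair v K] holds a value and a
   stack of instructions: programs, together with the return frames 10-11 (for
   PPair), 12 (PRec) and 13 (PMu) carrying their saved data in [d]. *)
Definition exec (X : set2w) (t d v K : nat) : nat :=
  if t == 0 then npair 0 K
  else if t == 1 then npair v.+1 K
  else if t == 2 then npair v K
  else if t == 3 then npair (X v) K
  else if t == 4 then npair (nfst v) K
  else if t == 5 then npair (nsnd v) K
  else if t == 6 then
    npair v (push (nfst d) (push (npair 10 (npair (nsnd d) v)) K))
  else if t == 7 then npair v (push (nsnd d) (push (nfst d) K))
  else if t == 8 then
    if nsnd v == 0 then npair (nfst v) (push (nfst d) K)
    else let w := npair (nfst v) (nsnd v).-1 in
      npair w (push (npair 8 d) (push (npair 12 (npair (nsnd d) w)) K))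
  else if t == 9 then
    let w := npair v 0 in npair w (push d (push (npair 13 (npair d w)) K))
  else if t == 10 then npair (nsnd d) (push (nfst d) (push (npair 11 v) K))
  else if t == 11 then npair (npair d v) K
  else if t == 12 then
    npair (npair (nfst (nsnd d)) (npair (nsnd (nsnd d)) v)) (push (nfst d) K)
  else if v == 0 then npair (nsnd (nsnd d)) K
  else let w := npair (nfst (nsnd d)) (nsnd (nsnd d)).+1 in
    npair w (push (nfst d) (push (npair 13 (npair (nfst d) w)) K)).

(** The stack 0 is empty, as [push] always returns a successor; such a configuration has halted and
    is a fixed point. *)
Definition step (X : set2w) (c : nat) : nat :=
  if nsnd c == 0 then c
  else let K := (nsnd c).-1 in
    exec X (nfst (nfst K)) (nsnd (nfst K)) (nfst c) (nsnd K).

Definition run X r s := iter s (step X) (npair (nsnd r) (push (nfst r) 0)).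

(* 0 while the computation is running, y.+1 once it has returned y *)
Definition output X r s :=
  if nsnd (run X r s) == 0 then (nfst (run X r s)).+1 else 0.

Lemma computable_exec X t d v K :
  computable_in X t -> computable_in X d -> computable_in X v ->
  computable_in X K ->
  computable_in X (fun n => exec X (t n) (d n) (v n) (K n)).
Proof.
move=> ct cd cv cK; rewrite /exec /push /=.
comput.
Qed.

Lemma computable_output X r s :
  computable_in X r -> computable_in X s ->
  computable_in X (fun n => output X (r n) (s n)).
Proof.
move=> cr cs.
have crun : computable_in X (fun n => run X (r n) (s n)).
  apply: (@computable_iter _ (fun _ => step X)) => //.
    rewrite /step; cbv beta zeta; apply: computable_if; [comput|comput|].
    by apply: computable_exec; comput.
  by rewrite /push; comput.
by rewrite /output; comput.
Qed.

(** * Completeness of the machine and convergence of its outputs *)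

Section Completeness.

Variable X : set2w.

Definition reach c c' := exists n, iter n (step X) c = c'.

Lemma reach_refl c : reach c c. Proof. by exists 0. Qed.

Lemma reach_trans c1 c2 c3 : reach c1 c2 -> reach c2 c3 -> reach c1 c3.
Proof. by move=> [n <-] [m <-]; exists (m + n); rewrite iterD. Qed.

Lemma reach_step c1 c2 : reach (step X c1) c2 -> reach c1 c2.
Proof. by apply: reach_trans; exists 1. Qed.

Lemma step_push t d v K :
  step X (npair v (push (npair t d) K)) = exec X t d v K.
Proof. by rewrite /step /push !(npairKl, npairKr). Qed.

Definition nproj := (npairKl, npairKr).

(* Proved by a bare fixpoint because [eval_ind] gives no induction hypothesis for
   the premises of [EMu] that sit under an existential. *)
Lemma eval_reach p x y :
  eval X p x y -> forall K, reach (npair x (push (pcode p) K)) (npair y K).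
Proof.
move: p x y; fix IH 4 => p x y; case=> {p x y}; cbn [pcode].
1-6: by move=> x K; apply: reach_step; rewrite step_push; apply: reach_refl.
- move=> f g x a b /IH fa /IH gb K;
    apply: reach_step; rewrite step_push /exec /= !nproj.
  apply: reach_trans (fa _) _;
    apply: reach_step; rewrite step_push /exec /= !nproj.
  apply: reach_trans (gb _) _; apply: reach_step; rewrite step_push /exec /=.
  exact: reach_refl.
- move=> f g x y z /IH gy /IH fz K;
    apply: reach_step; rewrite step_push /exec /= !nproj.
  exact: reach_trans (gy _) (fz _).
- move=> f g a y /IH fa K;
    apply: reach_step; rewrite step_push /exec /= !nproj.
  exact: fa.
- move=> f g a n y z /IH ry /IH gz K;
    apply: reach_step; rewrite step_push /exec /= !nproj.
  apply: reach_trans (ry _) _;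
    apply: reach_step; rewrite step_push /exec /= !nproj.
  exact: gz.
move=> f x n /IH f0 Hm K; apply: reach_step; rewrite step_push /exec /=.
have {}Hm m : m < n -> exists k, forall K,
    reach (npair (npair x m) (push (pcode f) K)) (npair k.+1 K).
  by move=> ltm; case: (Hm m ltm) => k /IH fk; exists k.
(* Here [m] counts the arguments still to be rejected before the search reaches [n]. *)
suff loop m : m <= n -> reach
    (npair (npair x (n - m)) (push (pcode f)
      (push (npair 13 (npair (pcode f) (npair x (n - m)))) K))) (npair n K).
  by have := loop n (leqnn n); rewrite subnn.
elim: m => [|m IHm] lem.
  rewrite subn0; apply: reach_trans (f0 _) _; apply: reach_step.
  by rewrite step_push /exec /= !nproj; apply: reach_refl.
have [|k fk] := Hm (n - m.+1); first by rewrite ltn_subrL (leq_trans _ lem).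
apply: reach_trans (fk _) _; apply: reach_step.
by rewrite step_push /exec /= !nproj subnSK // ; apply: IHm; apply: ltnW.
Qed.

Lemma run_halted r s t : nsnd (run X r s) = 0 -> s <= t -> run X r t = run X r s.
Proof.
move=> halt /subnK <-; rewrite /run iterD -/(run X r s).
by elim: (t - s) => //= n ->; rewrite /step halt.
Qed.

Lemma output_mono r s t y : output X r s = y.+1 -> s <= t -> output X r t = y.+1.
Proof.
rewrite {1}/output; case: eqP => // halt [<-] /(run_halted halt) rt.
by rewrite /output rt halt.
Qed.

Lemma eval_output p x y :
  eval X p x y ->
  exists s, forall t, s <= t -> output X (npair (pcode p) x) t = y.+1.
Proof.
case/eval_reach/(_ 0) => s rs; exists s => t; apply: output_mono.
by rewrite /output /run !nproj rs !nproj.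
Qed.

(** Excluded middle on halting: an output persists by [output_mono], and otherwise the value is 0 at
    every stage. *)
Lemma output_stable r : exists s, forall t, s <= t -> output X r t = output X r s.
Proof.
case: (classic (exists s y, output X r s = y.+1)) => [[s [y out]]|no].
  by exists s => t /(output_mono out) ->.
have out0 t : output X r t = 0.
  by case E: (output X r t) => [|y] //; case: no; exists t, y.
by exists 0 => t _; rewrite !out0.
Qed.

Lemma outputs_stable n :
  exists s, forall r t, r < n -> s <= t -> output X r t = output X r s.
Proof.
elim: n => [|n [s IHs]]; first by exists 0.
have [s' Hs'] := output_stable n; exists (maxn s s') => r t.
rewrite ltnS leq_eqVlt geq_max => /orP[/eqP->|ltr] /andP[st s't].
  by rewrite [RHS]Hs' ?leq_maxr // Hs'.
by rewrite [RHS]IHs ?leq_maxl // IHs.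
Qed.

End Completeness.

(** * Bounding program codes by Goedel numbers *)

Fixpoint pdepth (p : prog) : nat :=
  match p with
  | PPair f g | PComp f g | PRec f g => (maxn (pdepth f) (pdepth g)).+1
  | PMu f => (pdepth f).+1
  | _ => 1
  end.

Fixpoint tdepth (t : GenTree.tree nat) : nat :=
  if t is GenTree.Node _ f then (foldr maxn 0 (map tdepth f)).+1 else 0.

(** One iteration per level of depth: 9 is the largest constructor tag, and [npair b b] dominates
    the pair of two subprogram codes up to [b]. *)
Definition code_bound n := iter n (fun b => npair 9 (npair b b)) 0.

Lemma leq_code_bound m n : m <= n -> code_bound m <= code_bound n.
Proof.
move=> /subnK <-; elim: (n - m) => //= k /leq_trans; apply.
rewrite -ltnS npair_succ; set b := code_bound _.
have lb : b <= npair b b.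
  rewrite -ltnS npair_succ (leq_trans (ltn_expl b (ltnSn 1))) //.
  by rewrite leq_pmulr // addn1.
rewrite -[b.+1]mul1n leq_mul ?expn_gt0 // addn1 ltnS.
by rewrite (leq_trans lb) // leq_pmull.
Qed.

Lemma pcode_bound p : pcode p <= code_bound (pdepth p).
Proof.
have bin k f g : k <= 9 ->
    pcode f <= code_bound (pdepth f) -> pcode g <= code_bound (pdepth g) ->
    npair k (npair (pcode f) (pcode g))
      <= code_bound (maxn (pdepth f) (pdepth g)).+1.
  move=> lek lef leg; rewrite leq_npair // leq_npair //.
    by rewrite (leq_trans lef) // leq_code_bound // leq_maxl.
  by rewrite (leq_trans leg) // leq_code_bound // leq_maxr.
elim: p => [||||||f IHf g IHg|f IHf g IHg|f IHf g IHg|f IHf] /=;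
  try by apply: leq_npair.
- exact: bin.
- exact: bin.
- exact: bin.
apply: leq_npair => //; apply: leq_trans IHf _.
rewrite -ltnS npair_succ (leq_trans (ltn_expl _ (ltnSn 1))) //.
by rewrite leq_pmulr // addn1.
Qed.

Lemma prog_dec_depth t p : prog_dec t = Some p -> pdepth p <= tdepth t.
Proof.
elim: p t => [||||||f IHf g IHg|f IHf g IHg|f IHf g IHg|f IHf] [x|n s] //=;
  do 10?[case: n => [|n] //=]; case: s => [|t1 [|t2 [|t3 s]]] //=;
  case E1: (prog_dec t1) => [f1|] //=; try case E2: (prog_dec t2) => [f2|] //=;
  case=> *; subst; rewrite ?maxn0 ?ltnS;
  first [ exact: IHf
        | by rewrite geq_max !leq_max (IHf _ E1) (IHg _ E2) orbT ].
Qed.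

(** Prepending [v] turns the code [m] of a sequence into [2 ^ v * (2 * m + 1)], which exceeds
    [m]. *)
Lemma size_decode e : size (CodeSeq.decode e) <= e.
Proof.
rewrite -{2}[e]CodeSeq.decodeK; elim: (CodeSeq.decode e) => //= v s IHs.
rewrite -[(size s).+1]mul1n leq_mul ?expn_gt0 // ltnS.
by rewrite (leq_trans IHs) // -addnn leq_addr.
Qed.

Lemma foldr_maxn_leq s n : (foldr maxn 0 s <= n) = all (leq^~ n) s.
Proof. by elim: s => //= x s IHs; rewrite geq_max IHs. Qed.

(* The decoding stack never holds a tree deeper than the number of tokens
   consumed. *)
Lemma tree_decode_depth (c : seq (nat + nat)) t :
  GenTree.decode c = Some t -> tdepth t <= size c.
Proof.
rewrite /GenTree.decode; set fs := foldr _ _ c.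
suff [H _] : all (fun t => tdepth t <= size c) fs.1 /\
    all (all (fun t => tdepth t <= size c)) fs.2.
  by case: fs.1 H => //= t' s /andP[H _] [<-].
rewrite {}/fs; elim: c => //= x c; case: (foldr _ _ c) => fs1 fs2 /= [H1 H2].
have W (s : seq (GenTree.tree nat)) :
  all (fun t => tdepth t <= size c) s -> all (fun t => tdepth t <= (size c).+1) s.
  by apply: sub_all => u /leqW.
have W2 : all (all (fun t => tdepth t <= (size c).+1)) fs2 by apply: sub_all H2.
case: x => [[|n]|x] /=; rewrite ?W ?W2 //.
  rewrite ltnS foldr_maxn_leq all_map H1; split=> //.
  by case: fs2 H2 W2 => //= s fs2 _ /andP[].
by case: fs2 H2 W2 => //= s fs2 /andP[].
Qed.

(** A chain of bounds: [e] decodes to at most [e] tokens, the tree is no deeper than their number,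
    the program no deeper than the tree, and depth bounds the code. *)
Lemma unpickle_bound e p :
  (unpickle e : option prog) = Some p -> pcode p <= code_bound e.
Proof.
move=> ep; apply: leq_trans (pcode_bound p) _; apply: leq_code_bound.
pose c : seq (nat + nat) := pmap unpickle (CodeSeq.decode e).
(* Holds by unfolding the countable instances of programs, trees and sequences. *)
have {}ep : obind prog_dec (GenTree.decode c) = Some p by [].
case E: (GenTree.decode c) ep => [t|] //= /prog_dec_depth /leq_trans; apply.
apply: leq_trans (tree_decode_depth E) _.
by apply: leq_trans (size_decode e); rewrite size_pmap count_size.
Qed.

(** * Quotas and the owner colouring *)

Definition quota r := npair r.+2 r.

Lemma leq_quota m n : m <= n -> quota m <= quota n.
Proof. by move=> lemn; apply: leq_npair. Qed.

(** Each quota is more than twice the preceding one. The summand [r] will pay for the numbers below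
    [r], and 2 for the two survivors. *)
Lemma quota_sum r : \sum_(q < r) quota q + r + 2 <= quota r.
Proof.
have q2 q : (quota q).*2.+1 <= quota q.+1.
  rewrite -ltnS npair_succ -doubleS npair_succ -mul2n mulnA -expnS.
  by rewrite leq_mul // leq_add2r leq_mul2l leqnSn.
elim: r => [|r IHr]; first by rewrite big_ord0 -ltnS npair_succ.
rewrite big_ord_recr /=; apply: leq_trans (q2 r).
by set S := \sum_(_ < _) _ in IHr *; lia.
Qed.

Section OwnerColoring.

Variable D : nat -> seq nat.

(* The value is x.+1 when x lies in no D r with r <= x. *)
Definition owner x := find (fun r => x \in D r) (iota 0 x.+1).

(** The guard on [z] discards ownerless numbers; an ownerless [x] gets the colour [true]. *)
Definition least_owned x :=
  ~~ has (fun z => (owner z <= z) && (owner z == owner x)) (iota 0 x).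

Lemma owner_leq x r : r <= x -> x \in D r -> owner x <= r.
Proof.
move=> lerx xDr; rewrite leqNgt; apply/negP=> /(before_find 0).
by rewrite nth_iota // add0n xDr.
Qed.

Lemma owner_mem x : owner x <= x -> x \in D (owner x).
Proof.
rewrite -ltnS => lt; have hasD : has (fun r => x \in D r) (iota 0 x.+1).
  by rewrite has_find size_iota.
by have := nth_find 0 hasD; rewrite nth_iota.
Qed.

(** An element of [D r] is below [r], or lies in some [D q] with [q < r], or is owned by [r]. By
    [quota_sum] the first two kinds leave at least two elements of the third, and only the least of
    these is coloured [true]. *)
Lemma least_owned_splits r :
  (forall q, size (D q) <= quota q) -> uniq (D r) -> size (D r) = quota r ->
  exists a b, [/\ a \in D r, b \in D r & least_owned a != least_owned b].
Proof.
move=> leD uDr sDr; pose W := [seq x <- D r | (r <= x) && (owner x == r)].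
have WP x : (x \in W) = [&& r <= x, owner x == r & x \in D r].
  by rewrite mem_filter andbA.
have uW : uniq W by apply: filter_uniq.
have sW : 1 < size W.
  have sub : {subset D r <= iota 0 r ++ flatten [seq D q | q <- iota 0 r] ++ W}.
    move=> x xDr; rewrite !mem_cat mem_iota add0n /=.
    have [//|lerx] /= := ltnP x r; apply/orP.
    have := owner_leq lerx xDr; rewrite leq_eqVlt => /orP[eqr|ltr].
      by right; rewrite WP lerx eqr xDr.
    left; apply/flattenP; exists (D (owner x)).
      by rewrite map_f // mem_iota.
    by apply: owner_mem; apply: leq_trans (ltnW ltr) lerx.
  have leW := uniq_leq_size uDr sub; have leS := quota_sum r.
  rewrite !size_cat size_iota size_flatten /shape -map_comp sumnE big_map in leW.
  have iotaE : iota 0 r = index_iota 0 r by rewrite /index_iota subn0.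
  rewrite iotaE big_mkord in leW.
  have leD' : \sum_(q < r) size (D q) <= \sum_(q < r) quota q.
    by apply: leq_sum => q _; apply: leD.
  rewrite /= sDr in leW; move: leW leS leD'.
  by move: (size W) (\sum_(i < r) size _) (\sum_(q < r) _) => w A B; lia.
have exW : exists x, x \in W by exists (nth 0 W 0); apply: mem_nth; apply: ltnW.
case: (ex_minnP exW) => a Wa mina; exists a.
have [b Wb ltab] : exists2 b, b \in W & a < b.
  have : has (predC1 a) W.
    rewrite -[_ W]negbK -all_predC; apply/negP=> /allP alla.
    have : size W <= size [:: a].
      by apply: uniq_leq_size => // x /alla /=; rewrite negbK inE.
    by rewrite leqNgt sW.
  by case/hasP=> b Wb /= neq; exists b; rewrite // ltn_neqAle eq_sym neq mina.
exists b; move: (Wa) (Wb); rewrite !WP.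
move=> /and3P[lea /eqP oa aD] /and3P[_ /eqP ob bD].
split=> //; suff [-> ->] : least_owned a /\ ~~ least_owned b by [].
rewrite /least_owned negbK ob oa; split; last first.
  by apply/hasP; exists a; rewrite ?mem_iota // oa lea eqxx.
apply/hasPn=> z; rewrite mem_iota /= add0n => ltz; apply/negP=> /andP[lez /eqP oz].
suff /mina : z \in W by rewrite leqNgt ltz.
by rewrite WP -oz lez eqxx owner_mem.
Qed.

End OwnerColoring.

(** The colour of [x] consults only owners of numbers up to [x], hence finitely many sets; this is
    the source of stability. *)
Lemma eq_least_owned D D' x :
  (forall r, r <= x -> D r = D' r) -> least_owned D x = least_owned D' x.
Proof.
move=> eqD.
have eqo z : z <= x -> owner D z = owner D' z.
  move=> lez; apply: eq_in_find => r; rewrite mem_iota add0n ltnS /= => ler.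
  by rewrite eqD // (leq_trans ler).
congr (~~ _); apply: eq_in_has => z; rewrite mem_iota add0n /= => ltz.
by rewrite !eqo // ltnW.
Qed.

(** * The stage approximations: computability and stability *)

Definition elt y i := nfst (iter i nsnd y).

(** Through [elt] every number codes an infinite sequence, so any output supplies [quota r] entries,
    possibly with repetitions. *)
Definition stage X s r :=
  if output X r s is y.+1 then mkseq (elt y) (quota r) else [::].

Lemma computable_mem_stage X x s r :
  computable_in X x -> computable_in X s -> computable_in X r ->
  computable_in X (fun n => x n \in stage X (s n) (r n)).
Proof.
move=> cx cs cr; have co := computable_output cr cs.
have chas : computable_in X (fun n => has
    (fun i => elt (output X (r n) (s n)).-1 i == x n) (iota 0 (quota (r n)))).
  apply: computable_has; last by rewrite /quota; comput.
  apply: computable_eq; last by comput.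
  apply: computable_fst; apply: (@computable_iter _ (fun=> nsnd)); [comput|comput|].
  apply: computable_pred.
  exact: (computable_comp co (computable_fst (computable_id X))).
(* The value 0 of a running computation is treated apart, since its predecessor would be read as the
   output 0. *)
apply: eq_computable (computable_if (computable_eq co (computable_const X 0))
  (computable_const X 0) chas) => n.
rewrite /stage; case: (output X (r n) (s n)) => //= y.
congr (nat_of_bool _); apply/hasP/mapP => [[i lti /eqP <-]|[i lti ->]].
  by exists i.
by exists i.
Qed.

Lemma computable_owner X x s :
  computable_in X x -> computable_in X s ->
  computable_in X (fun n => owner (stage X (s n)) (x n)).
Proof.
move=> cx cs; apply: computable_find; last by comput.
by apply: computable_mem_stage; comput.
Qed.

Lemma computable_coloring X :
  computable_in X (fun n => least_owned (stage X (nsnd n)) (nfst n)).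
Proof.
apply: computable_neg; apply: computable_has; last by comput.
apply: computable_and.
  apply: computable_eq; last by comput.
  (* The comparison [owner z <= z] is by definition the vanishing of a truncated difference. *)
  by apply: computable_sub; [apply: computable_owner|]; comput.
by apply: computable_eq; apply: computable_owner; comput.
Qed.

Lemma coloring_stable X : stable (fun x s => least_owned (stage X s) x).
Proof.
move=> x; have [s Hs] := outputs_stable X x.+1.
exists s, (least_owned (stage X s) x) => t /ltnW les _.
by apply: eq_least_owned => r ler; rewrite /stage Hs.
Qed.

(** * Coding initial segments of an infinite set *)

Section Enumeration.

Variables (H : set2w) (infH : infinite_set H).

Lemma next_ex n : exists d, H (n.+1 + d).
Proof. by have [m [le Hm]] := infH n.+1; exists (m - n.+1); rewrite subnKC. Qed.

Definition next n := n.+1 + ex_minn (next_ex n).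

Lemma nextP n : H (next n).
Proof. by rewrite /next; case: ex_minnP. Qed.

Lemma ltn_next n : n < next n. Proof. exact: leq_addr. Qed.

Lemma computable_next : computable_in H next.
Proof.
apply: computable_add; first by comput.
apply: (@computable_mu _ (fun n d => H (n.+1 + d))).
- apply: computable_oracle; apply: computable_add; comput.
- by move=> n; case: ex_minnP.
by move=> n m; case: ex_minnP => d _; apply.
Qed.

(** The newest element stands in front, where [nfst] reads it to find its successor in [H]; the
    entries therefore decrease. *)
Definition prefix_code k := iter k (fun y => npair (next (nfst y)) y) 0.

Lemma elt_prefix_code k i :
  i <= k -> elt (prefix_code k) i = nfst (prefix_code (k - i)).
Proof.
move=> lei; congr nfst; elim: i lei => [|i IHi] lti; first by rewrite subn0.
by rewrite iterS IHi 1?ltnW // -subnSK // /prefix_code /= npairKr.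
Qed.

Lemma mem_prefix_code k i : i < k -> H (elt (prefix_code k) i).
Proof.
move=> lti; rewrite elt_prefix_code 1?ltnW // -subnSK // /prefix_code /= npairKl.
exact: nextP.
Qed.

Lemma uniq_prefix_code k n : n <= k -> uniq (mkseq (elt (prefix_code k)) n).
Proof.
move=> len; apply/mkseq_uniqP.
have incr : {homo nfst \o prefix_code : i j / i < j}.
  by apply: homo_ltn => [j i l|i]; [apply: ltn_trans|rewrite /= npairKl ltn_next].
have lt_elt i j : i < j -> j < n -> elt (prefix_code k) j < elt (prefix_code k) i.
  move=> ltij ltj; have lejk := leq_trans (ltnW ltj) len.
  rewrite !elt_prefix_code // 1?(leq_trans (ltnW ltij)) //.
  by apply: incr; apply: ltn_sub2l => //; apply: leq_trans lejk.
move=> i j lti ltj eqij; case: (ltngtP i j) => // lt.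
  by have := lt_elt _ _ lt ltj; rewrite eqij ltnn.
by have := lt_elt _ _ lt lti; rewrite eqij ltnn.
Qed.

End Enumeration.

(** * The diagonally noncomputable function *)

Theorem theorem2p3 (I : set2w -> Prop) : SRT22_model I -> DNR_model I.
Proof.
move=> [_ srt] X IX; pose C : coloring := fun x s => least_owned (stage X s) x.
have [|H [IH [infH [c homH]]]] := srt C _ (coloring_stable X).
  by exists X; split=> //; apply: computable_coloring.
(* [code_bound e] replaces the code of the program numbered [e], so by monotonicity the prefix is
   long enough whichever program that is. *)
pose h e := prefix_code infH (quota (npair (code_bound e) e)).
exists h; split.
  exists H; split=> //; apply: (@computable_iter _
    (fun _ y => npair (next infH (nfst y)) y)).
  - have cn := computable_next infH; comput.
  - rewrite /quota; have cb : computable_in H code_bound; last by comput.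
    by apply: (@computable_iter _ (fun _ b => npair 9 (npair b b))); comput.
  - exact: computable_const.
move=> e y; rewrite /Phi; case E: (unpickle e) => [p|] // ev hy.
have [s outs] := eval_output ev; pose r := npair (pcode p) e.
have ler : quota r <= quota (npair (code_bound e) e).
  by apply: leq_quota; apply: leq_npair => //; apply: unpickle_bound.
(* An element [t] of [H] above [m] and past stage [s] sees the full set of [r], and homogeneity
   gives all pairs of its elements with [t] the colour [c]. *)
pose m := \max_(x <- mkseq (elt y) (quota r)) x.
have [t [let_ Ht]] := infH (maxn s m.+1).
move: let_; rewrite geq_max => /andP[les ltm].
have stE : stage X t r = mkseq (elt y) (quota r) by rewrite /stage outs.
(* If [h e = y], the set of [r] consists of distinct elements of [H], so two of them get different
   colours with [t]. *)
have [|||a [b [aD bD]]] := @least_owned_splits (stage X t) r.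
- by move=> q; rewrite /stage; case: (output X q t) => //= z; rewrite size_mkseq.
- by rewrite stE -hy; apply: uniq_prefix_code.
- by rewrite stE size_mkseq.
have col x : x \in stage X t r -> C x t = c.
  rewrite stE => xD; apply: homH => //; last first.
    by apply: leq_trans ltm; rewrite ltnS; apply: leq_bigmax_seq.
  case/mapP: xD => i; rewrite mem_iota add0n => /andP[_ lti] ->.
  by rewrite -hy; apply: mem_prefix_code; apply: leq_trans lti ler.
by rewrite -/(C a t) -/(C b t) !col // eqxx.
Qed.
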